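(* Let $(M,\boldsymbol g)$ be a non-flat maximally symmetric space of dimension $n$, i.e. $R_{abcd}=\lambda(g_{ac}g_{bd}-g_{ad}g_{bc})$ with constant $\lambda\neq0$. (i) For $2\le p<n$, the decomposition of a conformal Killing-Yano tensor $\boldsymbol Y$ of order $p$ as $\boldsymbol Y=\boldsymbol A+\boldsymbol H$, with $\boldsymbol A$ a Killing-Yano tensor of order $p$ and $\boldsymbol H$ a closed conformal Killing-Yano tensor of order $p$, is unique. (ii) For $1\le p<n$, $M$ admits no covariantly constant skew-symmetric tensor of rank $p$ other than the zero tensor.
   Context: The metric has arbitrary signature, $\nabla$ is its Levi-Civita connection, and square brackets denote normalized (weight one) antisymmetrization. A tensor $\boldsymbol F$ is covariantly constant if $\nabla\boldsymbol F=0$. A maximally symmetric space of dimension $n$ is one admitting $\frac12n(n+1)$ independent Killing vector fields; its Riemann tensor has the form $R_{abcd}=\lambda(g_{ac}g_{bd}-g_{ad}g_{bc})$ with $\lambda$ a constant. A totally skew-symmetric tensor $\boldsymbol Y$ of rank $p$ is a conformal Killing-Yano tensor of order $p$ if there is a skew-symmetric tensor $\boldsymbol h$ of rank $p-1$ such that $$\nabla_a Y_{b_1b_2\cdots b_p}+\nabla_{b_1}Y_{ab_2\cdots b_p}=2g_{a[b_1}h_{b_2\cdots b_p]}+2g_{b_1[a}h_{b_2\cdots b_p]},$$ equivalently $\nabla_aY_{b_1\cdots b_p}=\nabla_{[a}Y_{b_1\cdots b_p]}+2g_{a[b_1}h_{b_2\cdots b_p]}$. It is a Killing-Yano tensor if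 $\boldsymbol h=0$, and a closed conformal Killing-Yano tensor if $\nabla_{[a}Y_{b_1\cdots b_p]}=0$. *)

(* Defs.v *)
(* Smooth manifolds are given by a smooth atlas, and tensor fields, in index
   notation, by their components in every chart of the atlas, subject to the
   usual transformation law on overlaps.  Components are functions of the
   coordinates x in the image of the chart; since they are total functions,
   every condition and every equality is required on the images of the charts
   only. *)
From HB Require Import structures.
From mathcomp Require Import all_boot all_order all_fingroup all_algebra.
From mathcomp Require Import all_classical all_reals all_analysis.
Set Implicit Arguments.
Unset Strict Implicit.
Unset Printing Implicit Defensive.
Import Order.TTheory GRing.Theory Num.Theory.
Import numFieldNormedType.Exports.
Local Open Scope classical_set_scope.
Local Open Scope ring_scope.

Definition pd (R : realType) (n : nat) (i : 'I_n) (f : 'rV[R]_n -> R)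
    (x : 'rV[R]_n) : R :=
  'D_(delta_mx 0 i) f x.

(* U is meant to be open. *)
Fixpoint Ck (R : realType) (n k : nat) (U : set 'rV[R]_n) (f : 'rV[R]_n -> R)
    : Prop :=
  (forall x, U x -> {for x, continuous f}) /\
  if k is k'.+1 then
    forall i : 'I_n,
      (forall x, U x -> derivable f x (delta_mx 0 i)) /\ Ck k' U (pd i f)
  else True.

Definition smooth (R : realType) (n : nat) (U : set 'rV[R]_n)
    (f : 'rV[R]_n -> R) : Prop :=
  forall k, Ck k U f.

(* The maps coord c and point c are total; they are mutually inverse
   homeomorphisms between dom c and the open set coord c @` dom c, and are
   unconstrained elsewhere. *)
Record manifold (R : realType) (n : nat) := Manifold {
  space :> topologicalType;
  manifold_hausdorff : hausdorff_space space;
  manifold_second_countable : @second_countable space;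
  chart : Type;
  dom : chart -> set space;
  coord : chart -> space -> 'rV[R]_n;
  point : chart -> 'rV[R]_n -> space;
  dom_open : forall c, open (dom c);
  dom_cover : forall m : space, exists c, dom c m;
  img_open : forall c, open (coord c @` dom c);
  coordK : forall c m, dom c m -> point c (coord c m) = m;
  coord_continuous : forall c m, dom c m -> {for m, continuous (coord c)};
  point_continuous : forall c x, (coord c @` dom c) x ->
    {for x, continuous (point c)};
  transition_smooth : forall c c' (j : 'I_n),
    smooth (coord c @` (dom c `&` dom c'))
      (fun x => coord c' (point c x) 0 j)
}.

Definition img (R : realType) (n : nat) (M : manifold R n) (c : chart M)
    : set 'rV[R]_n :=
  coord c @` dom c.

Definition overlap (R : realType) (n : nat) (M : manifold R n) (c c' : chart M)
    : set 'rV[R]_n :=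
  coord c @` (dom c `&` dom c').

Definition transition (R : realType) (n : nat) (M : manifold R n)
    (c c' : chart M) (x : 'rV[R]_n) : 'rV[R]_n :=
  coord c' (point c x).

(* T c x [tuple b1; ...; bk] is the component T_{b1...bk}, in the chart c, at
   the point with coordinates x. *)
Definition components (R : realType) (n : nat) (M : manifold R n) (k : nat) :=
  chart M -> 'rV[R]_n -> k.-tuple 'I_n -> R.

Definition tensor_field (R : realType) (n : nat) (M : manifold R n) (k : nat)
    (T : components M k) : Prop :=
  (forall c b, smooth (img c) (fun x => T c x b)) /\
  (forall c c' x b, overlap c c' x ->
    T c x b =
      \sum_(d : k.-tuple 'I_n)
        (\prod_(i < k) pd (tnth b i)
           (fun y => transition c c' y 0 (tnth d i)) x)
        * T c' (transition c c' x) d).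

Definition teq (R : realType) (n : nat) (M : manifold R n) (k : nat)
    (S T : components M k) : Prop :=
  forall c x b, img c x -> S c x b = T c x b.

Definition tzero (R : realType) (n : nat) (M : manifold R n) (k : nat)
    : components M k :=
  fun _ _ _ => 0.
Arguments tzero {R n} M k.

Definition tadd (R : realType) (n : nat) (M : manifold R n) (k : nat)
    (S T : components M k) : components M k :=
  fun c x b => S c x b + T c x b.

Definition permi (n k : nat) (s : 'S_k) (b : k.-tuple 'I_n) : k.-tuple 'I_n :=
  [tuple tnth b (s i) | i < k].

Definition skew_sym (R : realType) (n : nat) (M : manifold R n) (k : nat)
    (T : components M k) : Prop :=
  forall c x, img c x -> forall (s : 'S_k) b,
    T c x (permi s b) = (-1) ^+ s * T c x b.

Definition alt (R : realType) (n k : nat) (t : k.-tuple 'I_n -> R)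
    (b : k.-tuple 'I_n) : R :=
  (k`!%:R)^-1 * \sum_(s : 'S_k) (-1) ^+ s * t (permi s b).

Definition gmx (R : realType) (n : nat) (M : manifold R n)
    (g : components M 2) (c : chart M) (x : 'rV[R]_n) : 'M[R]_n :=
  \matrix_(a, b) g c x [tuple a; b].

(* Pseudo-Riemannian metrics: no condition on the signature. *)
Definition metric (R : realType) (n : nat) (M : manifold R n)
    (g : components M 2) : Prop :=
  tensor_field g /\
  forall c x, img c x ->
    (gmx g c x)^T = gmx g c x /\ gmx g c x \in unitmx.

(* christoffel g c d a b x = Gamma^d_{ab}, for the Levi-Civita connection. *)
Definition christoffel (R : realType) (n : nat) (M : manifold R n)
    (g : components M 2) (c : chart M) (d a b : 'I_n) (x : 'rV[R]_n) : R :=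
  2^-1 * \sum_(e < n) invmx (gmx g c x) d e *
    (pd a (fun y => g c y [tuple e; b]) x
     + pd b (fun y => g c y [tuple e; a]) x
     - pd e (fun y => g c y [tuple a; b]) x).

Definition subst_index (n k : nat) (b : k.-tuple 'I_n) (i : 'I_k) (d : 'I_n)
    : k.-tuple 'I_n :=
  [tuple if j == i then d else tnth b j | j < k].

(* (nabla T)_{a b1...bk} = nabla_a T_{b1...bk}. *)
Definition nabla (R : realType) (n : nat) (M : manifold R n)
    (g : components M 2) (k : nat) (T : components M k) : components M k.+1 :=
  fun c x ab =>
    let a := thead ab in
    let b : k.-tuple 'I_n := [tuple of behead ab] in
    pd a (fun y => T c y b) x
    - \sum_(i < k) \sum_(d < n)
        christoffel g c d a (tnth b i) x * T c x (subst_index b i d).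

Definition covariantly_constant (R : realType) (n : nat) (M : manifold R n)
    (g : components M 2) (k : nat) (T : components M k) : Prop :=
  teq (nabla g T) (tzero M k.+1).

(* R^e_{bcd}, with the sign convention for which round spheres have
   R_{abcd} = lambda (g_{ac} g_{bd} - g_{ad} g_{bc}) with lambda > 0. *)
Definition riemann_up (R : realType) (n : nat) (M : manifold R n)
    (g : components M 2) (ch : chart M) (e b c d : 'I_n) (x : 'rV[R]_n) : R :=
  pd c (christoffel g ch e d b) x - pd d (christoffel g ch e c b) x
  + \sum_(f < n) (christoffel g ch e c f x * christoffel g ch f d b x
                  - christoffel g ch e d f x * christoffel g ch f c b x).

Definition riemann (R : realType) (n : nat) (M : manifold R n)
    (g : components M 2) (ch : chart M) (a b c d : 'I_n) (x : 'rV[R]_n) : R :=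
  \sum_(e < n) g ch x [tuple a; e] * riemann_up g ch e b c d x.

(* Maximal symmetry, expressed through the form of the curvature tensor; lambda
   is a single constant for the whole of M. *)
Definition maximally_symmetric (R : realType) (n : nat) (M : manifold R n)
    (g : components M 2) (lambda : R) : Prop :=
  forall (ch : chart M) x (a b c d : 'I_n), img ch x ->
    riemann g ch a b c d x =
      lambda * (g ch x [tuple a; c] * g ch x [tuple b; d]
                - g ch x [tuple a; d] * g ch x [tuple b; c]).

(* g_{a[b1} h_{b2...bp]} with p = q.+1; the index a is not antisymmetrized. *)
Definition galt (R : realType) (n : nat) (M : manifold R n)
    (g : components M 2) (q : nat) (h : components M q)
    (c : chart M) (x : 'rV[R]_n) (a : 'I_n) (b : q.+1.-tuple 'I_n) : R :=
  alt (fun d : q.+1.-tuple 'I_n =>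
         g c x [tuple a; thead d] * h c x [tuple of behead d]) b.

(* The order p of Y is written q.+1 below, so that h has rank p - 1 = q. *)
Definition CKY_eq (R : realType) (n : nat) (M : manifold R n)
    (g : components M 2) (q : nat) (Y : components M q.+1) (h : components M q)
    : Prop :=
  forall c x (a b1 : 'I_n) (b : q.-tuple 'I_n), img c x ->
    nabla g Y c x [tuple of a :: b1 :: b]
    + nabla g Y c x [tuple of b1 :: a :: b]
    = 2 * galt g h c x a [tuple of b1 :: b]
      + 2 * galt g h c x b1 [tuple of a :: b].

Definition CKY (R : realType) (n : nat) (M : manifold R n)
    (g : components M 2) (q : nat) (Y : components M q.+1) : Prop :=
  [/\ tensor_field Y, skew_sym Y &
      exists h : components M q, [/\ tensor_field h, skew_sym h & CKY_eq g Y h]].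

Definition KY (R : realType) (n : nat) (M : manifold R n)
    (g : components M 2) (q : nat) (Y : components M q.+1) : Prop :=
  [/\ tensor_field Y, skew_sym Y & CKY_eq g Y (tzero M q)].

Definition closed_CKY (R : realType) (n : nat) (M : manifold R n)
    (g : components M 2) (q : nat) (Y : components M q.+1) : Prop :=
  CKY g Y /\
  forall c x b, img c x -> alt (nabla g Y c x) b = 0.

Definition KY_CCKY_decomposition (R : realType) (n : nat) (M : manifold R n)
    (g : components M 2) (q : nat) (Y A H : components M q.+1) : Prop :=
  [/\ KY g A, closed_CKY g H & teq Y (tadd A H)].

(* Main.v *)
(* Two decompositions differ by D = A - A' = H' - H. The Killing-Yano equation
   makes nabla A and nabla A', hence nabla D, totally skew, so nabla D equals its
   own alternation, which vanishes because H and H' are closed. Hence (i) reduces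
   to (ii). For (ii), if nabla T = 0, commuting second partial derivatives gives
     sum_i R^e_{b_i c a} T_{b_1..e..b_p} = 0,
   and contracting this with g^{b_1 a}, for curvature
   R_{abcd} = lambda (g_{ac} g_{bd} - g_{ad} g_{bc}), leaves
   lambda (n - p) T = 0. *)
Require Import Defs.
From mathcomp Require Import all_boot all_order all_fingroup all_algebra.
From mathcomp Require Import all_classical all_reals all_analysis.
From mathcomp Require Import ring lra.
Set Implicit Arguments.
Unset Strict Implicit.
Unset Printing Implicit Defensive.
Import Order.TTheory GRing.Theory Num.Theory.
Import numFieldNormedType.Exports.
Local Open Scope classical_set_scope.
Local Open Scope ring_scope.

(** * Symmetry of second derivatives *)

Lemma is_derive_line (R : realType) (V : normedModType R) (f : V -> R)
    (x v : V) (t df : R) :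
  is_derive (x + t *: v) v f df ->
  is_derive t 1 (fun s => f (x + s *: v)) df.
Proof.
have E : (fun h => h^-1 *: (((fun s => f (x + s *: v)) \o shift t) (h *: 1) -
                            f (x + t *: v))) =
         (fun h => h^-1 *: ((f \o shift (x + t *: v)) (h *: v) -
                            f (x + t *: v))).
  apply/funext => h /=; congr (_ *: (f _ - _)).
  by rewrite [h *: 1]mulr1 scalerDl addrCA.
by case=> df1 df2; split; [rewrite /derivable E | rewrite /derive E].
Qed.

Lemma MVT_itvcc (R : realType) (f df : R -> R) (h : R) :
  0 < h -> (forall s, 0 <= s <= h -> is_derive s 1 f (df s)) ->
  exists2 s, 0 <= s <= h & f h - f 0 = df s * h.
Proof.
move=> h0 dfs; have [||s /= hs Es] := @MVT R f df 0 h h0.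
- move=> s; rewrite in_itv /= => /andP[s0 s1]; apply: dfs.
  by rewrite !ltW.
- apply: derivable_within_continuous => s; rewrite in_itv /= => hs.
  by case: (dfs _ hs).
exists s; last by rewrite Es subr0.
by move: hs; rewrite in_itv /= => /andP[s0 s1]; rewrite !ltW.
Qed.

(** Two mean value theorems: first along [u], applied to the increment of [f] in direction [v], then
    along [v], applied to [fu]. Only the mixed derivative taken in the order [u], then [v], enters,
    so exchanging [u] and [v] gives an independent expression of the same quantity. *)
Lemma second_difference (R : realType) (V : normedModType R)
    (f fu fuv : V -> R) (x u v : V) (h : R) :
  0 < h ->
  (forall s t, 0 <= s <= h -> 0 <= t <= h ->
     let y := x + s *: u + t *: v in
     is_derive y u f (fu y) /\ is_derive y v fu (fuv y)) ->
  exists s t, [/\ 0 <= s <= h, 0 <= t <= h &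
    f (x + h *: u + h *: v) - f (x + h *: u) - (f (x + h *: v) - f x) =
    fuv (x + s *: u + t *: v) * h * h].
Proof.
move=> h0 df.
have [s hs Es] : exists2 s, 0 <= s <= h &
    (f (x + h *: v + h *: u) - f (x + h *: u)) -
    (f (x + h *: v + 0 *: u) - f (x + 0 *: u)) =
    (fu (x + h *: v + s *: u) - fu (x + s *: u)) * h.
  apply: (@MVT_itvcc R (fun s => f (x + h *: v + s *: u) - f (x + s *: u))
    (fun s => fu (x + h *: v + s *: u) - fu (x + s *: u))) => // s hs.
  apply: is_deriveB; apply: is_derive_line.
    by rewrite addrAC; apply: (df _ _ hs _).1; rewrite lexx ltW.
  have := (df _ 0 hs _).1; rewrite /= scale0r addr0; apply.
  by rewrite lexx ltW.
have [t ht Et] : exists2 t, 0 <= t <= h &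
    fu (x + s *: u + h *: v) - fu (x + s *: u + 0 *: v) =
    fuv (x + s *: u + t *: v) * h.
  apply: (@MVT_itvcc R (fun t => fu (x + s *: u + t *: v))
    (fun t => fuv (x + s *: u + t *: v))) => // t ht.
  by apply: is_derive_line; apply: (df _ _ hs ht).2.
exists s, t; split => //; move: Es Et; rewrite !scale0r !addr0 => Es Et.
by rewrite -Et (addrAC x (s *: u)) -Es (addrAC x (h *: u)); ring.
Qed.

(** The second difference of [f] over a small parallelogram at [x] is h^2 times a value of [fuv] and
    also h^2 times a value of [fvu], at two points close to [x]. Continuity at [x] then bounds the
    distance from [fuv x] to [fvu x] by any e > 0. *)
Lemma is_derive_comm (R : realType) (V : normedModType R)
    (f fu fv fuv fvu : V -> R) (x u v : V) :
  (\forall y \near x, [/\ is_derive y u f (fu y), is_derive y v f (fv y),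
     is_derive y v fu (fuv y) & is_derive y u fv (fvu y)]) ->
  {for x, continuous fuv} -> {for x, continuous fvu} -> fuv x = fvu x.
Proof.
move=> nf cvu cuv; apply/eqP; rewrite -subr_eq0 -normr_le0.
apply/ler_addgt0Pr => e e0; rewrite add0r.
have e2 : 0 < e / 2 by rewrite divr_gt0.
have /nbhs_ballP[d /= d0 dP] : \forall y \near x,
  [/\ [/\ is_derive y u f (fu y), is_derive y v f (fv y),
     is_derive y v fu (fuv y) & is_derive y u fv (fvu y)],
     `|fuv x - fuv y| < e / 2 & `|fvu x - fvu y| < e / 2].
  move/cvgrPdist_lt: cvu => /(_ _ e2) cvu.
  move/cvgrPdist_lt: cuv => /(_ _ e2) cuv.
  by apply: filterS3 nf cvu cuv => y.
have k0 : 0 < `|u| + `|v| + 1 by rewrite ltr_wpDl // addr_ge0.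
(* With this [h] every point of the parallelogram is at distance at most d / 2 from [x]; the summand
   1 keeps the denominator positive when [u] and [v] both vanish. *)
pose h := d / 2 / (`|u| + `|v| + 1).
have h0 : 0 < h by rewrite !divr_gt0.
have xd s t : 0 <= s <= h -> 0 <= t <= h -> ball x d (x + s *: u + t *: v).
  move=> /andP[s0 sh] /andP[t0 th].
  rewrite -ball_normE /= -addrA opprD addNKr normrN.
  rewrite (le_lt_trans (ler_normD _ _)) // !normrZ !ger0_norm //.
  have : s * `|u| + t * `|v| <= h * (`|u| + `|v| + 1).
    by rewrite !mulrDr mulr1 ler_wpDr ?(ltW h0) // lerD // ler_wpM2r.
  by move=> /le_lt_trans; apply; rewrite /h divfK ?gt_eqF //; lra.
have [|s [t [hs ht E1]]] := @second_difference R V f fu fuv x u v h h0.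
  move=> s t hs ht y; have [[? ? ? ?] _ _] := dP _ (xd _ _ hs ht).
  by [].
have [|t' [s' [ht' hs' E2]]] := @second_difference R V f fv fvu x v u h h0.
  move=> t' s' ht' hs'; rewrite /= addrAC.
  by have [[? ? ? ?] _ _] := dP _ (xd _ _ hs' ht').
have E : fuv (x + s *: u + t *: v) = fvu (x + t' *: v + s' *: u).
  apply: (mulIf (lt0r_neq0 h0)); apply: (mulIf (lt0r_neq0 h0)).
  by rewrite -E1 -E2 (addrAC x); ring.
have [_ A _] := dP _ (xd _ _ hs ht).
have [_ _ B] := dP _ (xd _ _ hs' ht').
rewrite addrAC -E in B; apply: ltW; rewrite (splitr e).
rewrite (le_lt_trans _ (ltrD A B)) // (le_trans _ (ler_normB _ _)) //.
by rewrite opprB addrA subrK.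
Qed.

Lemma Ck_continuous (R : realType) (n k : nat) (U : set 'rV[R]_n) f x :
  Ck k U f -> U x -> {for x, continuous f}.
Proof. by case: k => [|k] [cf _]; apply: cf. Qed.

Lemma CkS (R : realType) (n k : nat) (U : set 'rV[R]_n) f i :
  Ck k.+1 U f ->
  (forall x, U x -> derivable f x (delta_mx 0 i)) /\ Ck k U (pd i f).
Proof. by case=> _; apply. Qed.

Lemma pd_comm (R : realType) (n : nat) (U : set 'rV[R]_n) f x (i j : 'I_n) :
  open U -> smooth U f -> U x -> pd i (pd j f) x = pd j (pd i f) x.
Proof.
move=> oU /(_ 2) sf Ux.
have [[di ci] [dj cj]] := (CkS i sf, CkS j sf).
have [dij cij] := CkS j ci; have [dji cji] := CkS i cj.
apply: (@is_derive_comm R _ f (pd j f) (pd i f) _ _ x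
  (delta_mx 0 j) (delta_mx 0 i)).
- near=> y; have Uy : U y by near: y; apply: open_nbhs_nbhs.
  split; split; [exact: dj| |exact: di| |exact: dji| |exact: dij|]; reflexivity.
- exact: Ck_continuous cji Ux.
- exact: Ck_continuous cij Ux.
Unshelve. all: by end_near. Qed.

(** * Differentiability of sums, products, inverse matrices and Christoffel symbols *)

Lemma is_derive_bigsum (R : realType) (V : normedModType R) (I : Type)
    (r : seq I) (P : pred I) (F : I -> V -> R) (dF : I -> R) (x v : V) :
  (forall i, is_derive x v (F i) (dF i)) ->
  is_derive x v (fun y => \sum_(i <- r | P i) F i y) (\sum_(i <- r | P i) dF i).
Proof.
move=> dFi; elim: r => [|i r IH].
  rewrite big_nil; under eq_fun do rewrite big_nil.
  exact: is_derive_cst.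
rewrite big_cons; under eq_fun do rewrite big_cons.
by case: (P i) => //; apply: is_deriveD.
Qed.

Lemma derivable_bigsum (R : realType) (V : normedModType R) (I : Type)
    (r : seq I) (P : pred I) (F : I -> V -> R) (x v : V) :
  (forall i, derivable (F i) x v) ->
  derivable (fun y => \sum_(i <- r | P i) F i y) x v.
Proof.
move=> dF; have := @is_derive_bigsum R V I r P F (fun i => 'D_v (F i) x) x v.
by case=> // i; split.
Qed.

Lemma derivable_bigprod (R : realType) (V : normedModType R) (I : Type)
    (r : seq I) (P : pred I) (F : I -> V -> R) (x v : V) :
  (forall i, derivable (F i) x v) ->
  derivable (fun y => \prod_(i <- r | P i) F i y) x v.
Proof.
move=> dF; elim: r => [|i r IH].
  under eq_fun do rewrite big_nil; exact: derivable_cst.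
under eq_fun do rewrite big_cons.
by case: (P i) => //; apply: derivableM.
Qed.

Lemma derivable_det (R : realType) (V : normedModType R) (m : nat)
    (A : V -> 'M[R]_m) (x v : V) :
  (forall i j, derivable (fun y => A y i j) x v) ->
  derivable (fun y => \det (A y)) x v.
Proof.
move=> dA; apply: derivable_bigsum => s; apply: derivableM.
  exact: derivable_cst.
exact: derivable_bigprod.
Qed.

(** Cramer's formula: wherever the matrix is invertible, hence near [x], an entry of the inverse is
    a cofactor divided by the determinant, and both are differentiable. *)
Lemma derivable_invmx (R : realType) (V : normedModType R) (m : nat)
    (A : V -> 'M[R]_m) (x v : V) (i j : 'I_m) :
  (\forall y \near x, A y \in unitmx) ->
  (forall i j, derivable (fun y => A y i j) x v) ->
  derivable (fun y => invmx (A y) i j) x v.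
Proof.
move=> uA dA.
apply: (@near_eq_derivable _ _ _
  (fun y => (\det (A y))^-1 * ((-1) ^+ (j + i) * \det (row' j (col' i (A y)))))).
  by apply: filterS uA => y uAy; rewrite /invmx uAy !mxE.
apply: derivableM.
  apply: derivableV; last exact: derivable_det.
  by have := nbhs_singleton uA; rewrite unitmxE unitfE.
apply: derivableM; first exact: derivable_cst.
apply: derivable_det => k l; under eq_fun do rewrite !mxE.
exact: dA.
Qed.

Lemma open_near (T : topologicalType) (U : set T) (P : T -> Prop) (x : T) :
  open U -> U x -> (forall y, U y -> P y) -> \forall y \near x, P y.
Proof.
by move=> oU Ux UP; apply: filterS UP _; apply: open_nbhs_nbhs.
Qed.

(** The equation for [w] holds on [U] only, as for tensor components. Since [U] is open it holds
    near each point of [U], so limits and derivatives transfer, and the partial derivatives satisfy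
    an equation of the same kind, on which the induction runs. *)
Lemma CkB (R : realType) (n k : nat) (U : set 'rV[R]_n) (f g w : 'rV[R]_n -> R) :
  open U -> (forall x, U x -> w x = f x - g x) ->
  Ck k U f -> Ck k U g -> Ck k U w.
Proof.
move=> oU;
have cw (f' g' w' : 'rV[R]_n -> R) x :
    (forall y, U y -> w' y = f' y - g' y) -> U x ->
    {for x, continuous f'} -> {for x, continuous g'} -> {for x, continuous w'}.
  move=> wE' Ux cf cg; have := cvgB cf cg; rewrite -(wE' _ Ux) => H.
  have E : \forall y \near x, f' y - g' y = w' y.
    by apply: (open_near oU Ux) => y Uy; rewrite wE'.
  exact: cvg_trans (near_eq_cvg E) (H _).
elim: k f g w => [|k IH] f g w wE Cf Cg.
  by split=> // x Ux;
    exact: cw (wE) (Ux) (Ck_continuous Cf Ux) (Ck_continuous Cg Ux).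
split=> [x Ux|i].
  by
    exact: cw (wE) (Ux) (Ck_continuous Cf Ux) (Ck_continuous Cg Ux).
have [[df Cdf] [dg Cdg]] := (CkS i Cf, CkS i Cg).
have ww x : U x -> is_derive x (delta_mx 0 i) w (pd i f x - pd i g x).
  move=> Ux; apply: (@near_eq_is_derive _ _ _ (f - g)).
    by apply: (open_near oU Ux) => y Uy; rewrite wE.
  by apply: is_deriveB; split => //; [apply: df|apply: dg].
split=> [x Ux|]; first by case: (ww x Ux).
apply: IH Cdf Cdg => x Ux; by case: (ww x Ux).
Qed.

Lemma derivable_christoffel (R : realType) (n : nat) (M : manifold R n)
    (g : components M 2) (c : chart M) (d a b i : 'I_n) (x : 'rV[R]_n) :
  metric g -> img c x -> derivable (christoffel g c d a b) x (delta_mx 0 i).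
Proof.
move=> [[sg _] mg] cx; have oc : open (img c) by apply: img_open.
have dg e f j y : img c y ->
    derivable (fun y => g c y [tuple e; f]) y (delta_mx 0 j).
  by move=> cy; apply: (CkS j (sg c [tuple e; f] 1)).1.
have ddg e f j : derivable (pd j (fun y => g c y [tuple e; f])) x (delta_mx 0 i).
  by apply: (CkS i (CkS j (sg c [tuple e; f] 2)).2).1.
apply: derivableM; first exact: derivable_cst.
apply: derivable_bigsum => e; apply: derivableM.
  apply: derivable_invmx.
    by apply: (open_near oc cx) => y cy; have [] := mg _ _ cy.
  move=> k l; under eq_fun do rewrite mxE; exact: dg.
by apply: derivableB => //; apply: derivableD.
Qed.

(** * Index substitution and the algebra of the Ricci identity *)

Lemma nabla_cons (R : realType) (n : nat) (M : manifold R n)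
    (g : components M 2) (k : nat) (T : components M k) (c : chart M)
    (x : 'rV[R]_n) (a : 'I_n) (b : k.-tuple 'I_n) :
  nabla g T c x [tuple of a :: b] =
  pd a (fun y => T c y b) x - \sum_(i < k) \sum_(d < n)
        christoffel g c d a (tnth b i) x * T c x (subst_index b i d).
Proof.
rewrite /nabla theadE; have -> : [tuple of behead [tuple of a :: b]] = b.
  exact: val_inj.
by [].
Qed.

Lemma subst_indexE (n k : nat) (b : k.-tuple 'I_n) i d j :
  tnth (subst_index b i d) j = if j == i then d else tnth b j.
Proof. by rewrite tnth_mktuple. Qed.

Lemma subst_index_same (n k : nat) (b : k.-tuple 'I_n) i d e :
  subst_index (subst_index b i d) i e = subst_index b i e.
Proof.
by apply: eq_from_tnth => j; rewrite !subst_indexE; case: eqP.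
Qed.

Lemma subst_index_id (n k : nat) (b : k.-tuple 'I_n) i :
  subst_index b i (tnth b i) = b.
Proof.
by apply: eq_from_tnth => j; rewrite !subst_indexE; case: eqP => // ->.
Qed.

Lemma subst_indexC (n k : nat) (b : k.-tuple 'I_n) i j d e : i != j ->
  subst_index (subst_index b i d) j e = subst_index (subst_index b j e) i d.
Proof.
move=> ij; apply: eq_from_tnth => l; rewrite !subst_indexE.
by have [->|//] := eqVneq l j; rewrite eq_sym (negPf ij).
Qed.

Lemma permi_subst_index (n k : nat) (s : 'S_k) (b : k.-tuple 'I_n) i d :
  permi s (subst_index b (s i) d) = subst_index (permi s b) i d.
Proof.
apply: eq_from_tnth => j.
by rewrite tnth_mktuple !subst_indexE tnth_mktuple (inj_eq perm_inj).
Qed.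

(* The terms in which two different indices of t are acted on are symmetric
   under the exchange of a and c, hence cancel. *)
Lemma ricci_algebra (R : comNzRingType) (n k : nat)
    (Gam : 'I_n -> 'I_n -> 'I_n -> R) (dGam : 'I_n -> 'I_n -> 'I_n -> 'I_n -> R)
    (t : k.-tuple 'I_n -> R) (b : k.-tuple 'I_n) :
  let D2 c a := \sum_(i < k) \sum_(d < n)
    (dGam c d a (tnth b i) * t (subst_index b i d) +
     Gam d a (tnth b i) * \sum_(j < k) \sum_(f < n)
       Gam f c (tnth (subst_index b i d) j) *
       t (subst_index (subst_index b i d) j f)) in
  forall c a, D2 c a - D2 a c = \sum_(i < k) \sum_(e < n)
    (dGam c e a (tnth b i) - dGam a e c (tnth b i) +
     \sum_(f < n) (Gam e c f * Gam f a (tnth b i) -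
                   Gam e a f * Gam f c (tnth b i))) * t (subst_index b i e).
Proof.
move=> D2 c a.
pose O c a := \sum_(i < k) \sum_(j < k | j != i) \sum_(d < n) \sum_(f < n)
  Gam d a (tnth b i) * Gam f c (tnth b j) *
  t (subst_index (subst_index b i d) j f).
have OC : O c a = O a c.
  rewrite /O (exchange_big_dep xpredT) //=; apply: eq_bigr => i _.
  apply: eq_big => [j|j ij]; first by rewrite eq_sym.
  rewrite exchange_big; apply: eq_bigr => f _; apply: eq_bigr => d _.
  by rewrite subst_indexC 1?eq_sym // (mulrC (Gam d _ _)).
(* The terms with j = i replace the same index twice; summing over the intermediate index gives the
   product of Christoffel symbols that occurs in the curvature. The terms with j different from i
   form [O]. *)
have D2E c' a' : D2 c' a' = (\sum_(i < k) \sum_(e < n)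
    (dGam c' e a' (tnth b i) + \sum_(f < n) Gam e c' f * Gam f a' (tnth b i)) *
    t (subst_index b i e)) + O c' a'.
  rewrite /D2 /O -big_split; apply: eq_bigr => i _ /=.
  under eq_bigr do rewrite (bigD1 i) //= mulrDr addrA.
  rewrite big_split /=; congr (_ + _).
    rewrite big_split /=; under [RHS]eq_bigr do rewrite mulrDl.
    rewrite [RHS]big_split /=; congr (_ + _).
    under eq_bigr do rewrite mulr_sumr.
    rewrite exchange_big /=; apply: eq_bigr => e _.
    rewrite mulr_suml; apply: eq_bigr => f _.
    by rewrite subst_indexE eqxx subst_index_same mulrA [Gam f _ _ * _]mulrC.
  rewrite [RHS]exchange_big /=; apply: eq_bigr => d _.
  rewrite mulr_sumr; apply: eq_bigr => j ji.
  rewrite mulr_sumr; apply: eq_bigr => f _.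
  by rewrite subst_indexE (negPf ji) mulrA.
rewrite !D2E OC opprD addrACA subrr addr0 -sumrB; apply: eq_bigr => i _.
rewrite -sumrB; apply: eq_bigr => e _; rewrite -mulrBl; congr (_ * _).
by rewrite opprD addrACA -sumrB.
Qed.

(** * Contraction of the integrability condition with the inverse metric *)

Lemma sum_delta (R : nzRingType) (n : nat) (F : 'I_n -> R) (k : 'I_n) :
  \sum_d (d == k)%:R * F d = F k.
Proof.
rewrite (bigD1 k) //= eqxx mul1r big1 ?addr0 // => d /negPf ->.
by rewrite mul0r.
Qed.

(** Free the first index of [b] and contract it with [d] through the inverse metric, taking for [c]
    the original first entry of [b]. The summand i = 0 contributes (n - 1) t b, and each of the q
    others contributes - t b. Hence (n - (q + 1)) t b = 0, where the factor is nonzero because q + 1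
    < n. *)
Lemma skew_tensor_eq0 (R : numFieldType) (n q : nat) (gm : 'M[R]_n)
    (t : q.+1.-tuple 'I_n -> R) :
  gm^T = gm -> gm \in unitmx ->
  (forall (s : 'S_q.+1) b, t (permi s b) = (-1) ^+ s * t b) ->
  (forall b c d, \sum_(i < q.+1) (gm (tnth b i) d * t (subst_index b i c) -
                                 gm (tnth b i) c * t (subst_index b i d)) = 0) ->
  (q.+1 < n)%N -> forall b, t b = 0.
Proof.
move=> gsym gu tskew tg qn b.
pose G := invmx gm.
have Gsym k d : G k d = G d k.
  have GT : G^T = G by rewrite /G trmx_inv gsym.
  by rewrite -[in LHS]GT mxE.
have GgE k d : \sum_e G k e * gm e d = (k == d)%:R.
  by have := mulVmx gu => /matrixP/(_ k d); rewrite !mxE.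
have gGE k d : \sum_e gm k e * G e d = (k == d)%:R.
  by have := mulmxV gu => /matrixP/(_ k d); rewrite !mxE.
have tswap b' i : i != ord0 -> t (permi (tperm ord0 i) b') = - t b'.
  by move=> i0; rewrite tskew odd_tperm eq_sym i0 expr1 mulN1r.
pose c := tnth b ord0.
pose F (i : 'I_q.+1) d k := let b' := subst_index b ord0 k in
  gm (tnth b' i) d * t (subst_index b' i c) -
  gm (tnth b' i) c * t (subst_index b' i d).
have F0 : \sum_(i < q.+1) \sum_d \sum_k G d k * F i d k = 0.
  rewrite exchange_big big1 //= => d _; rewrite exchange_big big1 //= => k _.
  by rewrite -mulr_sumr /F tg mulr0.
have b0 : subst_index b ord0 c = b by rewrite subst_index_id.
(* The first product contains the trace of the identity, hence the factor n; in the second, the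
   inverse metric cancels the metric and puts [c] back in the first slot. *)
have Fi0 : \sum_d \sum_k G d k * F ord0 d k = n%:R * t b - t b.
  under eq_bigr => d _ do under eq_bigr => k _ do
    rewrite /F subst_indexE eqxx !subst_index_same b0 mulrBr !mulrA.
  under eq_bigr => d _ do rewrite sumrB -!mulr_suml !GgE eqxx mul1r.
  by rewrite sumrB sum_delta b0 sumr_const card_ord mulr_natl.
have FiS i : i != ord0 -> \sum_d \sum_k G d k * F i d k = - t b.
  move=> i0; have i0' : (ord0 == i) = false by rewrite eq_sym (negPf i0).
  (* A symmetric [G] contracted with two skew slots: exchanging d and k changes the sign of the
     sum. *)
  have E0 : \sum_d \sum_k G d k * t (subst_index (subst_index b ord0 k) i d) = 0.
    set X := LHS; have XN : X = - X.
      rewrite {1}/X exchange_big -sumrN; apply: eq_bigr => d _ /=.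
      rewrite -sumrN; apply: eq_bigr => k _; rewrite Gsym -mulrN; congr (_ * _).
      rewrite -(tswap _ _ i0); congr t; apply: eq_from_tnth => j.
      rewrite [RHS]tnth_mktuple !subst_indexE.
      case: (tpermP ord0 i j) => [->|->|/eqP jn0 /eqP jni].
      - by rewrite !eqxx i0'.
      - by rewrite !eqxx i0'.
      - by rewrite (negPf jn0) (negPf jni).
    by apply/eqP; move/eqP: XN; rewrite -subr_eq0 opprK -mulr2n mulrn_eq0.
  under eq_bigr => d _ do under eq_bigr => k _ do
    rewrite /F subst_indexE (negPf i0) mulrBr !(mulrCA (G d k)).
  under eq_bigr => d _ do rewrite sumrB -!mulr_sumr.
  rewrite sumrB -mulr_sumr E0 mulr0 subr0.
  (* In the remaining product the metric and its inverse cancel, moving entry i of [b] to slot 0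
     while [c] sits in slot i. This is [b] with these two entries exchanged, whence - t b. *)
  under eq_bigr => d _ do rewrite mulr_sumr.
  rewrite exchange_big /=.
  under eq_bigr => k _ do
    (under eq_bigr => d _ do rewrite mulrA; rewrite -mulr_suml gGE eq_sym).
  rewrite sum_delta -(tswap _ _ i0); congr t; apply: eq_from_tnth => j.
  rewrite [RHS]tnth_mktuple !subst_indexE.
  case: (tpermP ord0 i j) => [->|->|/eqP jn0 /eqP jni].
  - by rewrite !eqxx i0'.
  - by rewrite !eqxx.
  - by rewrite (negPf jn0) (negPf jni).
have : \sum_(i < q.+1) \sum_d \sum_k G d k * F i d k = (n%:R - q.+1%:R) * t b.
  rewrite big_ord_recl Fi0 (eq_bigr (fun=> - t b));
    last by move=> i _; apply: FiS.
  by rewrite sumr_const card_ord -[_ *+ q]mulr_natl -natr1; ring.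
rewrite F0 => /esym/eqP; rewrite mulf_eq0 subr_eq0 eqr_nat gtn_eqF //=.
by move/eqP.
Qed.

(** * Covariant derivatives of skew tensors and of differences; parallel skew tensors *)

(** Skewness holds on the whole open image of the chart, so it can be differentiated; in the
    Christoffel terms, reindexing the slots by [s] matches each correction with its permuted
    counterpart. *)
Lemma nabla_permi (R : realType) (n : nat) (M : manifold R n)
    (g : components M 2) (k : nat) (T : components M k)
    (c : chart M) (x : 'rV[R]_n) (a : 'I_n) (s : 'S_k) (b : k.-tuple 'I_n) :
  (forall b, derivable (fun y => T c y b) x (delta_mx 0 a)) ->
  skew_sym T -> img c x ->
  nabla g T c x [tuple of a :: permi s b] =
  (-1) ^+ s * nabla g T c x [tuple of a :: b].
Proof.
move=> dT skT cx; rewrite !nabla_cons mulrBr; congr (_ - _).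
  have E : is_derive x (delta_mx 0 a) (fun y => (-1) ^+ s * T c y b)
      ((-1) ^+ s * pd a (fun y => T c y b) x).
    by apply: is_deriveZ; split => //; apply: dT.
  case: E => _ <-; apply: near_eq_derive.
  have oc : open (img c) by apply: img_open.
  by apply: (open_near oc cx) => y cy; rewrite skT.
rewrite mulr_sumr [RHS](reindex_inj (@perm_inj _ s)) /=.
apply: eq_bigr => i _; rewrite mulr_sumr; apply: eq_bigr => d _.
by rewrite tnth_mktuple -permi_subst_index skT // mulrCA.
Qed.

Lemma nabla_teqB (R : realType) (n : nat) (M : manifold R n)
    (g : components M 2) (k : nat) (S T W : components M k)
    (c : chart M) (x : 'rV[R]_n) (b : k.+1.-tuple 'I_n) :
  tensor_field S -> tensor_field T ->
  (forall c x b, img c x -> W c x b = S c x b - T c x b) -> img c x ->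
  nabla g W c x b = nabla g S c x b - nabla g T c x b.
Proof.
move=> [sS _] [sT _] WE cx; rewrite [b]tuple_eta !nabla_cons.
set a := thead b; set b' := [tuple of behead b].
rewrite opprD addrACA -opprD; congr (_ - _).
  have E : is_derive x (delta_mx 0 a) ((fun y => S c y b') - (fun y => T c y b'))
      (pd a (fun y => S c y b') x - pd a (fun y => T c y b') x).
    by apply: is_deriveB; split => //;
      [apply: (CkS a (sS c b' 1)).1 | apply: (CkS a (sT c b' 1)).1].
  case: E => _ <-; apply: near_eq_derive.
  have oc : open (img c) by apply: img_open.
  by apply: (open_near oc cx) => y cy; rewrite WE.
rewrite -sumrB; apply: eq_bigr => i _; rewrite -sumrB; apply: eq_bigr => d _.
by rewrite WE // mulrBr.
Qed.

(** The argument takes place in one chart. Smoothness is asked of the components, so that the result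
    applies directly to a difference of two tensor fields. *)
Lemma covariantly_constant_eq0 (R : realType) (n : nat) (M : manifold R n)
    (g : components M 2) (lambda : R) (q : nat)
    (T : components M q.+1) :
  metric g -> maximally_symmetric g lambda -> lambda != 0 -> (q.+1 < n)%N ->
  (forall c b, smooth (img c) (fun x => T c x b)) -> skew_sym T ->
  covariantly_constant g T -> teq T (tzero M q.+1).
Proof.
move=> mg msg l0 qn sT skT ccT c x b cx.
have oc : open (img c) by apply: img_open.
have [gsym gu] := mg.2 _ _ cx.
pose Gam d a b := christoffel g c d a b x.
pose dGam e d a b := pd e (christoffel g c d a b) x.
have dT b' y a : img c y -> pd a (fun y => T c y b') y =
    \sum_(i < q.+1) \sum_(d < n)
       christoffel g c d a (tnth b' i) y * T c y (subst_index b' i d).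
  by move=> cy; apply/eqP; rewrite -subr_eq0 -nabla_cons ccT.
(* Product rule, with the first derivatives of [T] eliminated once more by [dT]; the result has
   exactly the shape of [D2] in [ricci_algebra]. *)
have ddT b' e a : pd e (pd a (fun y => T c y b')) x = \sum_(i < q.+1) \sum_(d < n)
    (dGam e d a (tnth b' i) * T c x (subst_index b' i d) +
     Gam d a (tnth b' i) * \sum_(j < q.+1) \sum_(f < n)
       Gam f e (tnth (subst_index b' i d) j) *
       T c x (subst_index (subst_index b' i d) j f)).
  have E : is_derive x (delta_mx 0 e) (fun y => \sum_(i < q.+1) \sum_(d < n)
       christoffel g c d a (tnth b' i) y * T c y (subst_index b' i d))
    (\sum_(i < q.+1) \sum_(d < n)
    (dGam e d a (tnth b' i) * T c x (subst_index b' i d) +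
     Gam d a (tnth b' i) * \sum_(j < q.+1) \sum_(f < n)
       Gam f e (tnth (subst_index b' i d) j) *
       T c x (subst_index (subst_index b' i d) j f))).
    apply: is_derive_bigsum => i; apply: is_derive_bigsum => d.
    rewrite -dT //; apply: is_derive_eq.
      apply: is_deriveM; split; try reflexivity.
        exact: derivable_christoffel.
      exact: (CkS e (sT c _ 1)).1.
    by rewrite addrC; congr (_ + _); apply: mulrC.
  case: E => _ <-; apply: near_eq_derive.
  by apply: (open_near oc cx) => y cy; rewrite dT.
(* Maximal symmetry is stated for the lowered curvature; raising its first index with the inverse
   metric turns two metric factors into Kronecker deltas. *)
have curv e' b' e a : riemann_up g c e' b' e a x =
    lambda * ((e' == e)%:R * gmx g c x b' a - (e' == a)%:R * gmx g c x b' e).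
  have -> : riemann_up g c e' b' e a x =
      \sum_d invmx (gmx g c x) e' d * riemann g c d b' e a x.
    have -> : riemann_up g c e' b' e a x =
        \sum_d (1%:M : 'M[R]_n) e' d * riemann_up g c d b' e a x.
      rewrite (bigD1 e') //= mxE eqxx mul1r big1 ?addr0 // => d /negPf.
      by rewrite mxE eq_sym => ->; rewrite mul0r.
    rewrite -(mulVmx gu); under eq_bigr do rewrite mxE mulr_suml.
    rewrite exchange_big; apply: eq_bigr => d _ /=.
    rewrite mulr_sumr; apply: eq_bigr => f _.
    by rewrite mulrA; congr (_ * _ * _); rewrite mxE.
  under eq_bigr do rewrite msg // mulrCA.
  rewrite -mulr_sumr; congr (_ * _).
  under eq_bigr do rewrite mulrBr !mulrA.
  have GgE d : \sum_f invmx (gmx g c x) e' f * g c x [tuple f; d] = (e' == d)%:R.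
    by have := mulVmx gu => /matrixP/(_ e' d); rewrite !mxE => <-;
      apply: eq_bigr => f _; rewrite mxE.
  by rewrite sumrB -!mulr_suml !GgE !mxE.
rewrite /tzero.
refine (@skew_tensor_eq0 R n q (gmx g c x) (T c x) gsym gu _ _ qn b) => [s b'|b' e a].
  exact: skT.
(* The left side is a commutator of second partial derivatives of [T], hence zero. By [curv] the
   right side is [lambda] times the sum required by [skew_tensor_eq0], and [lambda] can be
   cancelled. *)
have := @ricci_algebra R n q.+1 Gam dGam (T c x) b' e a.
rewrite /= -!ddT (pd_comm _ _ oc (sT c b') cx) subrr => /esym E.
apply: (mulfI l0); rewrite mulr0 -[RHS]E mulr_sumr; apply: eq_bigr => i _.
under [RHS]eq_bigr => d _ do
  rewrite -[X in X * _]/(riemann_up g c d (tnth b' i) e a x) curv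
    -mulrA mulrBl -!mulrA.
by rewrite -mulr_sumr sumrB !sum_delta.
Qed.

(** * Total skewness of the derivative of a Killing-Yano tensor *)

Lemma permi_permi (n k : nat) (s t : 'S_k) (b : k.-tuple 'I_n) :
  permi s (permi t b) = permi (s * t)%g b.
Proof. by apply: eq_from_tnth => i; rewrite !tnth_mktuple permM. Qed.

Lemma permi_lift (n k : nat) (s : 'S_k) (a : 'I_n) (b : k.-tuple 'I_n) :
  permi (lift_perm ord0 ord0 s) [tuple of a :: b] = [tuple of a :: permi s b].
Proof.
apply: eq_from_tnth => i; rewrite tnth_mktuple.
have [j ->|->] := unliftP ord0 i; last by rewrite lift_perm_id.
by rewrite lift_perm_lift !tnthS tnth_mktuple.
Qed.

(** The permutations fixing the first slot, together with the exchange of the first two slots,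
    generate the symmetric group, and the permutations acting on [t] by their sign are closed under
    products. *)
Lemma skew_from_tail (R : comNzRingType) (n k : nat) (t : k.+2.-tuple 'I_n -> R) :
  (forall (s : 'S_k.+1) a b,
     t [tuple of a :: permi s b] = (-1) ^+ s * t [tuple of a :: b]) ->
  (forall a a' (b : k.-tuple 'I_n),
     t [tuple of a :: a' :: b] = - t [tuple of a' :: a :: b]) ->
  forall (s : 'S_k.+2) b, t (permi s b) = (-1) ^+ s * t b.
Proof.
move=> t_tail t_swap.
pose good (s : 'S_k.+2) := forall b, t (permi s b) = (-1) ^+ s * t b.
have goodM s1 s2 : good s1 -> good s2 -> good (s1 * s2)%g.
  by move=> g1 g2 b; rewrite -permi_permi g1 g2 odd_permM signr_addb mulrA.
have good_lift s : good (lift_perm ord0 ord0 s).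
  by case/tupleP=> a b; rewrite permi_lift t_tail odd_lift_perm addbF.
pose o1 : 'I_k.+2 := lift ord0 ord0.
have good01 : good (tperm ord0 o1).
  move=> b; rewrite odd_tperm /= expr1 mulN1r.
  case/tupleP: b => a b; case/tupleP: b => a' b.
  rewrite [in RHS]t_swap opprK; congr t; apply: eq_from_tnth => i.
  rewrite tnth_mktuple; case: (tpermP ord0 o1 i) => [->|->|i0 i1].
  - by rewrite !(tnth_nth a).
  - by rewrite !(tnth_nth a).
  case: i i0 i1 => [[|[|i]] Hi] i0 i1; rewrite !(tnth_nth a) //=.
  - by case: i0; apply: val_inj.
  - by case: i1; apply: val_inj.
(* Conjugating the exchange of slots 0 and 1 by a permutation that fixes slot 0 and sends 1 to i + 1
   gives the exchange of 0 and i + 1. *)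
have good0 (i : 'I_k.+1) : good (tperm ord0 (lift ord0 i)).
  pose s := lift_perm ord0 ord0 (tperm ord0 i).
  have -> : tperm ord0 (lift ord0 i) = (tperm ord0 o1 ^ s)%g.
    by rewrite tpermJ lift_perm_id lift_perm_lift tpermL.
  rewrite conjgE /s lift_permV; apply: (goodM) => //; exact: goodM.
have good0' i : good (tperm ord0 i).
  have [j ->|->] := unliftP ord0 i => //.
  by rewrite tperm1 => b; rewrite odd_perm1 mul1r; congr t;
    apply: eq_from_tnth => j; rewrite tnth_mktuple perm1.
move=> s; have [ts -> _] := prod_tpermP s.
elim: ts => [|[i j] ts IH].
  rewrite big_nil => b; rewrite odd_perm1 mul1r; congr t.
  by apply: eq_from_tnth => j; rewrite tnth_mktuple perm1.
rewrite big_cons; apply: (goodM) => //=.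
have [->|i0] := eqVneq i ord0; first exact: good0'.
have [->|j0] := eqVneq j ord0; first by rewrite tpermC; apply: good0'.
have [->|ij] := eqVneq i j.
  rewrite tperm1 => b; rewrite odd_perm1 mul1r; congr t.
  by apply: eq_from_tnth => l; rewrite tnth_mktuple perm1.
(* Any other transposition is a conjugate of one moving slot 0 by another such transposition. *)
have -> : tperm i j = (tperm ord0 j ^ tperm ord0 i)%g.
  by rewrite tpermJ tpermL tpermD // eq_sym.
by rewrite conjgE tpermV; apply: (goodM) => //; apply: goodM.
Qed.

Lemma alt_skew (R : realType) (n k : nat) (t : k.-tuple 'I_n -> R) b :
  (forall (s : 'S_k) b, t (permi s b) = (-1) ^+ s * t b) -> alt t b = t b.
Proof.
move=> tskew; rewrite /alt (eq_bigr (fun=> t b)) => [|s _].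
  by rewrite sumr_const card_Sn -[t b *+ _]mulr_natl mulKf.
by rewrite tskew mulrA -signr_addb addbb mul1r.
Qed.

Lemma galt0 (R : realType) (n : nat) (M : manifold R n)
    (g : components M 2) (q : nat) (c : chart M) (x : 'rV[R]_n) (a : 'I_n)
    (b : q.+1.-tuple 'I_n) :
  galt g (tzero M q) c x a b = 0.
Proof.
by rewrite /galt /alt big1 ?mulr0 // => s _; rewrite /tzero !mulr0.
Qed.

(** With h = 0 the defining equation is skewness in the derivative index and the first index of [A];
    skewness in the remaining slots is inherited from [A]. *)
Lemma KY_nabla_skew (R : realType) (n : nat) (M : manifold R n)
    (g : components M 2) (q : nat) (A : components M q.+1)
    (c : chart M) (x : 'rV[R]_n) :
  KY g A -> img c x ->
  forall (s : 'S_q.+2) b,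
    nabla g A c x (permi s b) = (-1) ^+ s * nabla g A c x b.
Proof.
move=> [[sA _] skA kA] cx; apply: skew_from_tail => [s a b|a a' b].
  by apply: nabla_permi => // b'; apply: (CkS a (sA c b' 1)).1.
by apply/eqP; rewrite -addr_eq0 kA // !galt0 mulr0 addr0.
Qed.

(** * Uniqueness of the decomposition and absence of parallel skew tensors *)

Theorem theorem3 (R : realType) (n : nat) (M : manifold R n)
    (g : components M 2) (lambda : R)
    (g_metric : metric g)
    (M_max_sym : maximally_symmetric g lambda)
    (lambda_neq0 : lambda != 0) :
  (forall q : nat, (2 <= q.+1 < n)%N ->
    forall Y : components M q.+1, CKY g Y ->
    forall A H A' H' : components M q.+1,
      KY_CCKY_decomposition g Y A H ->
      KY_CCKY_decomposition g Y A' H' ->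
      teq A A' /\ teq H H')
  /\
  (forall p : nat, (1 <= p < n)%N ->
    forall T : components M p,
      tensor_field T -> skew_sym T -> covariantly_constant g T ->
      teq T (tzero M p)).
Proof.
split=> [q /andP[_ qn] Y _ A H A' H' [kA [[tH skH _] cH] YE]
                                      [kA' [[tH' skH' _] cH'] YE']|].
  have [[tA skA _] [tA' skA' _]] := (kA, kA').
  pose D : components M q.+1 := fun c x b => A c x b - A' c x b.
  have DH c x b : img c x -> D c x b = H' c x b - H c x b.
    move=> cx; have := YE c x b cx; rewrite YE' // /tadd /D => E.
    by apply/eqP; rewrite subr_eq addrAC eq_sym subr_eq addrC E addrC.
  have D0 : teq D (tzero M q.+1).
    apply: (covariantly_constant_eq0 g_metric M_max_sym lambda_neq0 qn).
    - move=> c b k; apply: (@CkB _ _ _ _ (fun x => A c x b) (fun x => A' c x b)).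
      + exact: img_open.
      + by [].
      + exact: (tA.1 c b k).
      + exact: (tA'.1 c b k).
    - by move=> c x cx s b; rewrite /D skA // skA' // mulrBr.
    move=> c x b cx; rewrite /tzero.
    (* Here [D] is read as A - A', which makes its derivative totally skew and so equal to its own
       alternation. *)
    rewrite -[LHS](@alt_skew R n _ (nabla g D c x)); last first.
      move=> s b'; rewrite !(@nabla_teqB _ _ _ _ _ A A' D) //.
      by rewrite (KY_nabla_skew kA cx) (KY_nabla_skew kA' cx) [RHS]mulrBr.
    (* Here [D] is read as H' - H: the zero on the right is written as the difference of the two
       vanishing alternations, and alternation is linear. *)
    rewrite -[RHS](subrr 0) -[in X in _ = X - _](cH' c x b cx).
    rewrite -[in RHS](cH c x b cx).
    rewrite /alt -mulrBr -sumrB; congr (_ * _); apply: eq_bigr => s _.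
    by rewrite -[RHS]mulrBr; congr (_ * _); apply: nabla_teqB.
  split=> c x b cx.
    by apply/eqP; rewrite -subr_eq0; apply/eqP; apply: D0.
  by apply/esym/eqP; rewrite -subr_eq0 -DH //; apply/eqP; apply: D0.
case=> // p /andP[_ pn] T [sT _] skT ccT.
exact: (covariantly_constant_eq0 g_metric M_max_sym lambda_neq0 pn sT skT ccT).
Qed.
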